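(* Consider a Markov decision process with state space $\mathcal{S}=[0,1]^d$, action space $\mathcal{A}=\mathbb{R}$, environment transition kernel $P(s'\mid s,a)$, discount factor $\gamma\in[0,1)$, horizon $T\in\mathbb{N}\cup\{\infty\}$, and reward function $r:\mathcal{S}\times\mathcal{A}\to[r_{\min},r_{\max}]$ with $|r(s,a)|\le r_{\max}$ for all $(s,a)$. Let $$f(s)=\sum_{i=1}^H W_{2,i}\,\phi\Big(\sum_{k=1}^d W_{1,ik}s_k+b_{1,i}\Big)+b_2$$ be a one-hidden-layer fully connected network, where $\phi:\mathbb{R}\to(a,b)\subseteq\mathbb{R}$ is $L_\phi$-Lipschitz. Fix an input index $j\in\{1,\dots,d\}$ and let $f_p$ be the ''pruned'' network obtained from $f$ by setting $W_{1,ij}=0$ for all $i=1,\dots,H$ (all other parameters unchanged). Let $\sigma_f>0$ and define the Gaussian policies $\pi_\theta(\cdot\mid s)=\mathcal{N}(f(s),\sigma_f^2)$ and $\pi_{\theta_p}(\cdot\mid s)=\mathcal{N}(f_p(s),\sigma_f^2)$. For $i\in\{1,2\}$ (index $1$ for $\pi_\theta$, index $2$ for $\pi_{\theta_p}$), let $p_i(s'\mid s)=\int P(s'\mid s,a)\,\pi_i(a\mid s)\,da$ be the induced state-to-state kernel, let both processes start from the same initial state distribution $p_1^0=p_2^0$, and let $p_i^t$ denote the state distribution at time $t$, i.e. $p_i^t(s')=\int p_i(s'\mid s)p_i^{t-1}(s)\,ds$. Assume $\delta\ge 0$ is such that $\sup_t \mathbb{E}_{s\sim p_1^{t}}\big[D_{TV}(p_1(\cdot\mid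 s)\,\|\,p_2(\cdot\mid s))\big]\le\delta$. Then $$|J(\pi_\theta)-J(\pi_{\theta_p})|\le 2r_{\max}\Big[\frac{\gamma\delta}{(1-\gamma)^2}+\frac{B_j}{\sigma_f(1-\gamma)}\Big],\qquad B_j=L_\phi\sum_{i=1}^H|W_{2,i}W_{1,ij}|.$$
   Context: For a policy $\pi$, $J(\pi)=\mathbb{E}\big[\sum_{t=0}^T\gamma^t r(s_t,a_t)\big]$ where $s_0\sim p^0$, $a_t\sim\pi(\cdot\mid s_t)$, $s_{t+1}\sim P(\cdot\mid s_t,a_t)$. The total variation distance between densities $p,q$ on the same space is $D_{TV}(p\|q)=\frac12\int|p(x)-q(x)|\,dx$. *)

(* Defs.v *)
From HB Require Import structures.
From mathcomp Require Import all_boot all_order all_algebra.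
From mathcomp Require Import all_classical all_reals all_analysis.
Set Implicit Arguments. Unset Strict Implicit. Unset Printing Implicit Defensive.
Import Order.TTheory GRing.Theory Num.Theory.
Local Open Scope classical_set_scope.
Local Open Scope ring_scope.

Section rl_defs.
Context {R : realType} {d : nat}.
(* States are d-tuples of reals; the state space is the cube [0,1]^d. *)
Local Notation S := (d.-tuple R).

Definition cube : set S := [set s | forall k : 'I_d, 0 <= tnth s k <= 1].

Definition net (H : nat) (phi : R -> R) (W1 : 'I_H -> 'I_d -> R)
  (b1 : 'I_H -> R) (W2 : 'I_H -> R) (b2 : R) (s : S) : R :=
  \sum_(i < H) W2 i * phi (\sum_(k < d) W1 i k * tnth s k + b1 i) + b2.

Definition prune (H : nat) (W1 : 'I_H -> 'I_d -> R) (j : 'I_d) :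
  'I_H -> 'I_d -> R := fun i k => if k == j then 0 else W1 i k.

Definition gauss_policy (m : S -> R) (sig : R) (s : S) (a : R) : R :=
  normal_pdf (m s) sig a.

Definition induced_kernel (P : S -> R -> S -> R) (pi : S -> R -> R)
  (s s' : S) : R :=
  \int[@lebesgue_measure R]_(a in setT) (P s a s' * pi s a).

Variable mu : {measure set S -> \bar R}. (* reference measure "ds" *)

Fixpoint state_dist (p0 : S -> R) (k : S -> S -> R) (t : nat) : S -> R :=
  match t with
  | 0 => p0
  | t'.+1 => fun s' => \int[mu]_(s in setT) (k s s' * state_dist p0 k t' s)
  end.

Definition TV (p q : S -> R) : R :=
  2^-1 * \int[mu]_(x in setT) `|p x - q x|.

Definition expected_reward (pt : S -> R) (pi : S -> R -> R)
  (r : S -> R -> R) : R :=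
  \int[mu]_(s in setT)
     (pt s * \int[@lebesgue_measure R]_(a in setT) (pi s a * r s a)).

(* horizon T in N U {oo}: Some T = finite horizon T, None = infinite *)
Definition discounted_sum (T : option nat) (gamma : R) (rt : nat -> R) : R :=
  match T with
  | Some T => \sum_(0 <= t < T.+1) gamma ^+ t * rt t
  | None => limn (fun n => \sum_(0 <= t < n) gamma ^+ t * rt t)
  end.

(* J(pi) = E[ sum_{t=0}^T gamma^t r(s_t, a_t) ], written via the marginal
   state distributions p^t of the trajectory *)
Definition J (T : option nat) (gamma : R) (p0 : S -> R)
  (P : S -> R -> S -> R) (r : S -> R -> R) (pi : S -> R -> R) : R :=
  discounted_sum T gamma
    (fun t => expected_reward (state_dist p0 (induced_kernel P pi) t) pi r).

End rl_defs.

(* Main.v *)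
Require Import Defs.
From HB Require Import structures.
From mathcomp Require Import all_boot all_order all_algebra.
From mathcomp Require Import all_classical all_reals all_analysis.
From mathcomp Require Import measurable_realfun ring lra.
Set Implicit Arguments.
Unset Strict Implicit.
Unset Printing Implicit Defensive.
Import Order.TTheory GRing.Theory Num.Theory.
Import numFieldNormedType.Exports.
Local Open Scope classical_set_scope.
Local Open Scope ring_scope.

(* Call a nonnegative density of mass at most 1 a subdensity.  Writing p_t, q_t
   for the state densities of the two policies and k, k' for their kernels,
     k p_t - k' q_t = (k - k') p_t + k' (p_t - q_t),
   so one step increases the L1 distance by at most 2 delta, and
   |p_t - q_t|_1 <= 2 t delta.  Pruning moves the mean of the Gaussian by at
   most B_j on the cube; since the Hellinger affinity of two Gaussians of equal
   variance at distance D is exp (- D^2 / (8 sigma^2)), Le Cam's inequality bounds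
   their L1 distance by D / sigma.  The expected rewards at time t thus differ by
   at most rmax (B_j / sigma + 2 t delta), to be summed against gamma^t.

   The hypotheses on P and r only concern states in the cube.  Both are cut off
   outside of it, which does not change J because every p_t is supported there.

   Working with subdensities avoids almost everywhere arguments: an infinite real
   integral is 0 by convention, which can only decrease a mass. *)

Lemma ge0_fine_le (R : realType) (x : \bar R) : (0 <= x -> (fine x)%:E <= x)%E.
Proof. by case: x => [x||] //= _; rewrite leey. Qed.

Lemma ge0_dist_fine_le (R : realType) (x y z : \bar R) :
  (0 <= x -> 0 <= y -> 0 <= z -> x <= y + z -> y <= x + z ->
   `|fine x - fine y|%:E <= z)%E.
Proof.
case: x => [x||] //; case: y => [y||] //; case: z => [z||] //= _ _;
  rewrite ?leey// ?lee_fin => z0 xyz yxz; rewrite ?subrr ?normr0//.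
by rewrite ler_norml; apply/andP; split; lra.
Qed.

(* AM-GM applied to the two factors of [u ^+ 2 - v ^+ 2 = (u - v) * (u + v)]. *)
Lemma dist_sqr_amgm (R : realFieldType) (e u v : R) : 0 <= u -> 0 <= v ->
  e * `|u ^+ 2 - v ^+ 2| + 4 * (u * v) <= (2 + e ^+ 2 / 4) * (u ^+ 2 + v ^+ 2).
Proof.
move=> u0 v0; rewrite subr_sqr normrM (ger0_norm (addr_ge0 u0 v0)) -subr_ge0.
have -> : (2 + e ^+ 2 / 4) * (u ^+ 2 + v ^+ 2) -
    (e * (`|u - v| * (u + v)) + 4 * (u * v)) =
    2 * (`|u - v| - e / 4 * (u + v)) ^+ 2 + (e * (u - v)) ^+ 2 / 8 +
    2 * ((u - v) ^+ 2 - `|u - v| ^+ 2) by field.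
by rewrite real_normK ?num_real// subrr mulr0 addr0 addr_ge0// mulr_ge0// sqr_ge0.
Qed.

Section real_integrands.
Context d (T : measurableType d) (R : realType).
Variable mu : {measure set T -> \bar R}.
Implicit Types f g h : T -> R.

Lemma ge0_le_integral_EFin f g :
  measurable_fun setT f -> measurable_fun setT g ->
  (forall x, 0 <= f x) -> (forall x, f x <= g x) ->
  (\int[mu]_x (f x)%:E <= \int[mu]_x (g x)%:E)%E.
Proof.
move=> mf mg f0 fg; apply: ge0_le_integral => //.
- by move=> x _; rewrite lee_fin.
- exact/measurable_EFinP.
- exact/measurable_EFinP.
- by move=> x _; rewrite lee_fin.
Qed.

Lemma ge0_integralD_EFin f g :
  measurable_fun setT f -> measurable_fun setT g ->
  (forall x, 0 <= f x) -> (forall x, 0 <= g x) ->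
  (\int[mu]_x (f x + g x)%:E =
   \int[mu]_x (f x)%:E + \int[mu]_x (g x)%:E)%E.
Proof.
move=> mf mg f0 g0; under eq_integral do rewrite EFinD.
apply: ge0_integralD => //.
- by move=> x _; rewrite lee_fin.
- exact/measurable_EFinP.
- by move=> x _; rewrite lee_fin.
- exact/measurable_EFinP.
Qed.

Lemma ge0_integralM_EFin (c : R) f :
  0 <= c -> measurable_fun setT f -> (forall x, 0 <= f x) ->
  (\int[mu]_x (c * f x)%:E = c%:E * \int[mu]_x (f x)%:E)%E.
Proof.
move=> c0 mf f0; under eq_integral do rewrite EFinM.
apply: ge0_integralZl_EFin => //; last exact/measurable_EFinP.
by move=> x _; rewrite lee_fin.
Qed.

Lemma integrable_norm_le f (c : R) : measurable_fun setT f ->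
  (\int[mu]_x `|f x|%:E <= c%:E)%E -> mu.-integrable setT (EFin \o f).
Proof.
move=> mf fc; apply/integrableP; split; first exact/measurable_EFinP.
exact: le_lt_trans fc (ltry _).
Qed.

Lemma norm_Rintegral_le f (c : R) : measurable_fun setT f ->
  (\int[mu]_x `|f x|%:E <= c%:E)%E -> `|\int[mu]_x f x| <= c.
Proof.
move=> mf fc; have fint := integrable_norm_le mf fc.
rewrite -lee_fin (le_trans _ fc)// EFin_normr_Rintegral//.
by apply: le_abse_integral => //; exact/measurable_EFinP.
Qed.

Lemma Rintegral_eq0 f : (forall x, f x = 0) -> \int[mu]_x f x = 0.
Proof.
move=> f0; rewrite /Rintegral; under eq_integral do rewrite f0.
by rewrite integral0.
Qed.

Lemma integral_normM_le f g (c : R) :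
  measurable_fun setT f -> measurable_fun setT g ->
  0 <= c -> (forall x, `|g x| <= c) ->
  (\int[mu]_x `|f x * g x|%:E <= c%:E * \int[mu]_x `|f x|%:E)%E.
Proof.
move=> mf mg c0 gc.
have mnf : measurable_fun setT (fun x => `|f x|) by exact: measurableT_comp.
rewrite -ge0_integralM_EFin//; apply: ge0_le_integral_EFin => //.
- by apply: measurableT_comp => //; exact: measurable_funM.
- exact: measurable_funM.
- by move=> x; rewrite normrM mulrC ler_wpM2r.
Qed.

Lemma measurable_dist f g : measurable_fun setT f -> measurable_fun setT g ->
  measurable_fun setT (fun x => `|f x - g x|).
Proof.
by move=> mf mg; apply: measurableT_comp => //; exact: measurable_funB.
Qed.

Definition L1_dist f g : \bar R := (\int[mu]_x `|f x - g x|%:E)%E.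

Lemma L1_dist_ge0 f g : (0 <= L1_dist f g)%E.
Proof. by apply: integral_ge0 => x _; rewrite lee_fin. Qed.

Lemma L1_distxx f : L1_dist f f = 0%E.
Proof.
by rewrite /L1_dist; under eq_integral do rewrite subrr normr0; rewrite integral0.
Qed.

Lemma L1_distC f g : L1_dist f g = L1_dist g f.
Proof. by apply: eq_integral => x _; rewrite distrC. Qed.

Lemma L1_dist_triangle g f h : measurable_fun setT f ->
  measurable_fun setT g -> measurable_fun setT h ->
  (L1_dist f h <= L1_dist f g + L1_dist g h)%E.
Proof.
move=> mf mg mh; have mfg := measurable_dist mf mg.
have mgh := measurable_dist mg mh.
rewrite /L1_dist -ge0_integralD_EFin//; apply: ge0_le_integral_EFin => //.
- exact: measurable_dist.
- exact: measurable_funD.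
- by move=> x; exact: ler_distD.
Qed.

Lemma ge0_integral_le_L1_dist f g :
  measurable_fun setT f -> measurable_fun setT g ->
  (forall x, 0 <= f x) -> (forall x, 0 <= g x) ->
  (\int[mu]_x (f x)%:E <= \int[mu]_x (g x)%:E + L1_dist f g)%E.
Proof.
move=> mf mg f0 g0; have mfg := measurable_dist mf mg.
rewrite /L1_dist -ge0_integralD_EFin//; apply: ge0_le_integral_EFin => //.
- exact: measurable_funD.
- by move=> x; rewrite -lerBlDl; exact: ler_norm.
Qed.

(* No integrability is needed: [fine] sends +oo to 0, and if exactly one of the
   two integrals is infinite then so is the L1 distance. *)
Lemma ge0_dist_Rintegral_le f g :
  measurable_fun setT f -> measurable_fun setT g ->
  (forall x, 0 <= f x) -> (forall x, 0 <= g x) ->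
  (`|\int[mu]_x f x - \int[mu]_x g x|%:E <= L1_dist f g)%E.
Proof.
move=> mf mg f0 g0; apply: ge0_dist_fine_le.
- by apply: integral_ge0 => x _; rewrite lee_fin.
- by apply: integral_ge0 => x _; rewrite lee_fin.
- exact: L1_dist_ge0.
- exact: ge0_integral_le_L1_dist.
- by rewrite L1_distC; exact: ge0_integral_le_L1_dist.
Qed.

End real_integrands.

Section subdensity.
Context d (T : measurableType d) (R : realType).
Variable mu : {measure set T -> \bar R}.
Implicit Types p q u v : T -> R.

Definition subdensity p := [/\ measurable_fun setT p, forall x, 0 <= p x &
  (\int[mu]_x (p x)%:E <= 1)%E].

Lemma subdensity0 : subdensity (fun=> 0).
Proof. by split=> //; rewrite integral0. Qed.

Lemma L1_dist_subdensity_le2 p q : subdensity p -> subdensity q ->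
  (L1_dist mu p q <= 2%:E)%E.
Proof.
move=> [mp p0 p1] [mq q0 q1].
have -> : 2%:E = (1 + 1)%E :> \bar R by rewrite -EFinD.
apply: le_trans (leeD p1 q1); rewrite -ge0_integralD_EFin//.
apply: ge0_le_integral_EFin => //.
- exact: measurable_dist.
- exact: measurable_funD.
- by move=> x; rewrite (le_trans (ler_normB _ _))// !ger0_norm.
Qed.

Definition hellinger_affinity p q : \bar R :=
  (\int[mu]_x (Num.sqrt (p x * q x))%:E)%E.

Lemma L1_dist_affinity_amgm p q (e : R) :
  subdensity p -> subdensity q -> 0 <= e ->
  (e%:E * L1_dist mu p q + 4%:E * hellinger_affinity p q <=
   (4 + e ^+ 2 / 2)%:E)%E.
Proof.
move=> [mp p0 p1] [mq q0 q1] e0; have mpq := measurable_dist mp mq.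
have msqrt : measurable_fun setT (fun x => Num.sqrt (p x * q x)).
  apply: (@measurableT_comp _ _ _ _ _ _ (@Num.sqrt R)).
  - by apply: continuous_measurable_fun; exact: sqrt_continuous.
  - exact: measurable_funM.
have mD : measurable_fun setT (fun x => p x + q x) by exact: measurable_funD.
have pD0 x : 0 <= p x + q x by exact: addr_ge0.
have cst0 : 0 <= 2 + e ^+ 2 / 4 by rewrite addr_ge0// divr_ge0// sqr_ge0.
rewrite -!ge0_integralM_EFin// -ge0_integralD_EFin; first last.
- by move=> x; rewrite mulr_ge0// sqrtr_ge0.
- by move=> x; rewrite mulr_ge0.
- exact: measurable_funM.
- exact: measurable_funM.
apply: (@le_trans _ _ (\int[mu]_x ((2 + e ^+ 2 / 4) * (p x + q x))%:E)%E).
  apply: ge0_le_integral_EFin => [|| x | x].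
  - by apply: measurable_funD; exact: measurable_funM.
  - exact: measurable_funM.
  - by rewrite addr_ge0 ?mulr_ge0 ?sqrtr_ge0.
  - rewrite sqrtrM// -{1 3}(sqr_sqrtr (p0 x)) -{1 3}(sqr_sqrtr (q0 x)).
    by apply: dist_sqr_amgm; exact: sqrtr_ge0.
rewrite ge0_integralM_EFin// ge0_integralD_EFin//.
have -> : 4 + e ^+ 2 / 2 = (2 + e ^+ 2 / 4) * (1 + 1) by field.
by rewrite EFinM lee_wpmul2l ?lee_fin// EFinD leeD.
Qed.

(* Le Cam's inequality |p - q|_1 <= sqrt (8 (1 - affinity)), with [e] in place of
   the square root. *)
Lemma L1_dist_le_affinity p q (e : R) : subdensity p -> subdensity q -> 0 < e ->
  ((1 - e ^+ 2 / 8)%:E <= hellinger_affinity p q)%E ->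
  (L1_dist mu p q <= e%:E)%E.
Proof.
move=> pd qd e0 affinity_ge.
have : (e%:E * L1_dist mu p q + 4%:E * (1 - e ^+ 2 / 8)%:E <=
    (4 + e ^+ 2 / 2)%:E)%E.
  apply: le_trans (L1_dist_affinity_amgm pd qd (ltW e0)).
  by rewrite leeD2l// lee_wpmul2l// lee_fin.
case: (L1_dist mu p q) (L1_dist_ge0 mu p q) => [l _||] //; last first.
  by rewrite mulry gtr0_sg// mul1e.
by rewrite -!EFinM -EFinD !lee_fin => el_le; rewrite -(ler_pM2l e0); lra.
Qed.

Definition density_mean p u : R := \int[mu]_x (p x * u x).

Section bounded_observable.
Variables (u : T -> R) (M : R).
Hypotheses (measurable_u : measurable_fun setT u) (M0 : 0 <= M).
Hypothesis uM : forall x, `|u x| <= M.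

Lemma integral_norm_density_mean_le p : subdensity p ->
  (\int[mu]_x `|p x * u x|%:E <= M%:E)%E.
Proof.
move=> [mp p0 p1]; apply: le_trans (integral_normM_le mu mp measurable_u M0 uM) _.
rewrite -[leRHS]mule1 lee_wpmul2l ?lee_fin//.
by under eq_integral do rewrite ger0_norm//.
Qed.

Lemma integrable_density_mean p : subdensity p ->
  mu.-integrable setT (EFin \o (fun x => p x * u x)).
Proof.
move=> pd; have [mp _ _] := pd.
apply: integrable_norm_le (integral_norm_density_mean_le pd).
exact: measurable_funM.
Qed.

Lemma norm_density_mean_le p : subdensity p -> `|density_mean p u| <= M.
Proof.
move=> pd; have [mp _ _] := pd.
apply: norm_Rintegral_le (integral_norm_density_mean_le pd).
exact: measurable_funM.
Qed.

Lemma density_mean_distl_le p q (c : R) : subdensity p -> subdensity q ->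
  (L1_dist mu p q <= c%:E)%E ->
  `|density_mean p u - density_mean q u| <= M * c.
Proof.
move=> pd qd pqc; have [mp _ _] := pd; have [mq _ _] := qd.
have mpq : measurable_fun setT (fun x => p x - q x) by exact: measurable_funB.
rewrite -RintegralB//; [|exact: integrable_density_mean..].
under eq_Rintegral do rewrite -mulrBl.
apply: norm_Rintegral_le; first exact: measurable_funM.
apply: le_trans (integral_normM_le mu mpq measurable_u M0 uM) _.
by rewrite EFinM lee_wpmul2l// lee_fin.
Qed.

End bounded_observable.

Lemma density_mean_distr_le p u v (M c : R) : subdensity p ->
  measurable_fun setT u -> measurable_fun setT v -> 0 <= M -> 0 <= c ->
  (forall x, `|u x| <= M) -> (forall x, `|v x| <= M) ->
  (forall x, `|u x - v x| <= c) ->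
  `|density_mean p u - density_mean p v| <= c.
Proof.
move=> pd measurable_u measurable_v M0 c0 uM vM uvc.
rewrite -RintegralB//; [|exact: (integrable_density_mean _ M0)..].
under eq_Rintegral do rewrite -mulrBr.
by apply: norm_density_mean_le => //; exact: measurable_funB.
Qed.

End subdensity.

Section gaussian.
Context {R : realType}.
Implicit Types m s x : R.

Lemma subdensity_normal_pdf m s : subdensity lebesgue_measure (normal_pdf m s).
Proof.
split; [exact: measurable_normal_pdf|exact: normal_pdf_ge0|].
by rewrite integral_normal_pdf.
Qed.

Lemma sqrt_normal_pdfM m m' s x : s != 0 ->
  Num.sqrt (normal_pdf m s x * normal_pdf m' s x) =
  expR (- (m - m') ^+ 2 / (s ^+ 2 * 8)) * normal_pdf ((m + m') / 2) s x.
Proof.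
move=> s0; set rhs := RHS.
have rhs0 : 0 <= rhs by rewrite mulr_ge0 ?expR_ge0// normal_pdf_ge0.
rewrite -[rhs]ger0_norm// -sqrtr_sqr; congr Num.sqrt.
rewrite /rhs !normal_pdfE// /normal_fun.
rewrite mulrACA -expRD mulrCA exprMn -expr2; congr (_ * _).
by rewrite [RHS]expr2 -!expRD; congr expR; rewrite -[s ^+ 2 *+ 2]mulr_natr; field.
Qed.

Lemma hellinger_affinity_normal_pdf m m' s : s != 0 ->
  hellinger_affinity lebesgue_measure (normal_pdf m s) (normal_pdf m' s) =
  (expR (- (m - m') ^+ 2 / (s ^+ 2 * 8)))%:E.
Proof.
move=> s0; rewrite /hellinger_affinity.
under eq_integral do rewrite sqrt_normal_pdfM//.
rewrite ge0_integralM_EFin ?expR_ge0 ?integral_normal_pdf ?mule1//.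
- exact: measurable_normal_pdf.
- exact: normal_pdf_ge0.
Qed.

Lemma L1_dist_normal_pdf_le m m' s : 0 < s ->
  (L1_dist lebesgue_measure (normal_pdf m s) (normal_pdf m' s) <=
   (`|m - m'| / s)%:E)%E.
Proof.
move=> s0; have sn0 : s != 0 by rewrite gt_eqF.
have [->|mm'] := eqVneq m m'; first by rewrite L1_distxx subrr normr0 mul0r.
apply: L1_dist_le_affinity; [exact: subdensity_normal_pdf..| |].
  by rewrite divr_gt0// normr_gt0 subr_eq0.
rewrite hellinger_affinity_normal_pdf// lee_fin.
apply: le_trans (expR_ge1Dx _).
by rewrite expr_div_n real_normK ?num_real// mulNr -mulrA -invfM.
Qed.

End gaussian.

Section joint_measurability.
Context d1 d2 (X : measurableType d1) (Y : measurableType d2) (R : realType).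
Implicit Types f g : X -> Y -> R.

Definition jointly_measurable f :=
  measurable_fun setT (fun z : X * Y => f z.1 z.2).

Lemma jointly_measurable_row f x :
  jointly_measurable f -> measurable_fun setT (f x).
Proof. exact: measurable_fun_pair2. Qed.

Lemma jointly_measurable_dist f g :
  jointly_measurable f -> jointly_measurable g ->
  jointly_measurable (fun x y => `|f x y - g x y|).
Proof. exact: measurable_dist. Qed.

Lemma measurable_integral_joint (nu : {sigma_finite_measure set Y -> \bar R}) f :
  jointly_measurable f ->
  measurable_fun setT (fun x => (\int[nu]_y (f x y)%:E)%E).
Proof.
move=> mf; pose F (z : X * Y) := (f z.1 z.2)%:E.
have mF : measurable_fun setT F by exact/measurable_EFinP.
rewrite (_ : (fun x => _) =
    fun x => (fubini_F nu F^\+ x - fubini_F nu F^\- x)%E); last first.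
  apply/funext => x; rewrite /fubini_F [LHS]integralE.
  by congr (_ - _)%E; apply: eq_integral => y _; rewrite ?funeposE ?funenegE.
apply: emeasurable_funB; apply: measurable_fun_fubini_tonelli_F => //.
- exact: measurable_funepos.
- exact: measurable_funeneg.
Qed.

Lemma measurable_Rintegral_joint (nu : {sigma_finite_measure set Y -> \bar R}) f :
  jointly_measurable f -> measurable_fun setT (fun x => \int[nu]_y f x y).
Proof.
by move=> mf; apply: measurableT_comp => //; exact: measurable_integral_joint.
Qed.

Definition subkernel (nu : {measure set Y -> \bar R}) (k : X -> Y -> R) :=
  jointly_measurable k /\ forall x, subdensity nu (k x).

Definition mixture (mu : {measure set X -> \bar R}) (k : X -> Y -> R)
  (p : X -> R) (y : Y) : R := \int[mu]_x (k x y * p x).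

End joint_measurability.

Section mixture_theory.
Context d1 d2 (X : measurableType d1) (Y : measurableType d2) (R : realType).
Variable mu : {sigma_finite_measure set X -> \bar R}.
Variable nu : {sigma_finite_measure set Y -> \bar R}.
Implicit Types (k : X -> Y -> R) (p q : X -> R).
Local Notation subkernel := (subkernel nu).
Local Notation mixture := (mixture mu).

Lemma jointly_measurable_mixture_integrand k p :
  jointly_measurable k -> measurable_fun setT p ->
  jointly_measurable (fun y x => k x y * p x).
Proof.
move=> mk mp; apply: measurable_funM.
- exact: (measurableT_comp mk (@measurable_swap _ _ Y X)).
- exact: (measurableT_comp mp measurable_snd).
Qed.

Lemma measurable_mixture k p :
  jointly_measurable k -> measurable_fun setT p ->
  measurable_fun setT (mixture k p).
Proof.
move=> mk mp; apply: measurable_Rintegral_joint.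
exact: jointly_measurable_mixture_integrand.
Qed.

Lemma integral_mixture k p :
  jointly_measurable k -> measurable_fun setT p ->
  (forall x y, 0 <= k x y) -> (forall x, 0 <= p x) ->
  (\int[nu]_y \int[mu]_x (k x y * p x)%:E =
   \int[mu]_x ((p x)%:E * \int[nu]_y (k x y)%:E))%E.
Proof.
move=> mk mp k0 p0.
rewrite (fubini_tonelli (fun z : Y * X => (k z.2 z.1 * p z.2)%:E))//=.
- apply: eq_integral => x _; under eq_integral do rewrite mulrC.
  by rewrite ge0_integralM_EFin//; exact: jointly_measurable_row.
- by apply/measurable_EFinP; exact: jointly_measurable_mixture_integrand.
- by move=> z; rewrite lee_fin mulr_ge0.
Qed.

Lemma integral_mixture_le k p : subkernel k ->
  measurable_fun setT p -> (forall x, 0 <= p x) ->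
  (\int[nu]_y \int[mu]_x (k x y * p x)%:E <= \int[mu]_x (p x)%:E)%E.
Proof.
move=> [mk kd] mp p0; rewrite integral_mixture//; last first.
  by move=> x y; have [] := kd x.
apply: ge0_le_integral => //.
- move=> x _; rewrite mule_ge0 ?lee_fin//; apply: integral_ge0 => y _.
  by rewrite lee_fin; have [] := kd x.
- apply: emeasurable_funM; first exact/measurable_EFinP.
  exact: measurable_integral_joint.
- exact/measurable_EFinP.
- move=> x _; rewrite -[leRHS]mule1 lee_wpmul2l ?lee_fin//.
  by have [] := kd x.
Qed.

Lemma subdensity_mixture k p : subkernel k -> subdensity mu p ->
  subdensity nu (mixture k p).
Proof.
move=> kk [mp p0 p1]; have [mk kd] := kk.
have k0 x y : 0 <= k x y by have [] := kd x.
have kp0 y : (0 <= \int[mu]_x (k x y * p x)%:E)%E.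
  by apply: integral_ge0 => x _; rewrite lee_fin mulr_ge0.
have m0 y : 0 <= mixture k p y by exact: fine_ge0.
have mm := measurable_mixture mk mp.
split=> //; apply: le_trans p1; apply: le_trans (integral_mixture_le kk mp p0).
apply: ge0_le_integral => //.
- by move=> y _; rewrite lee_fin.
- exact/measurable_EFinP.
- apply: (@measurable_integral_joint _ _ _ _ _ mu).
  exact: jointly_measurable_mixture_integrand.
- by move=> y _; exact: ge0_fine_le.
Qed.

Lemma L1_dist_mixture_le k k' p p' : subkernel k -> subkernel k' ->
  subdensity mu p -> subdensity mu p' ->
  (L1_dist nu (mixture k p) (mixture k' p') <=
   \int[nu]_y \int[mu]_x `|k x y * p x - k' x y * p' x|%:E)%E.
Proof.
move=> [mk kd] [mk' kd'] [mp p0 _] [mp' p'0 _].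
have k0 x y : 0 <= k x y by have [] := kd x.
have k'0 x y : 0 <= k' x y by have [] := kd' x.
have mkp := jointly_measurable_mixture_integrand mk mp.
have mkp' := jointly_measurable_mixture_integrand mk' mp'.
apply: ge0_le_integral => //.
- by apply/measurable_EFinP; apply: measurable_dist; exact: measurable_mixture.
- apply: (@measurable_integral_joint _ _ _ _ _ mu).
  exact: jointly_measurable_dist mkp mkp'.
- move=> y _; apply: ge0_dist_Rintegral_le.
  + exact: jointly_measurable_row mkp.
  + exact: jointly_measurable_row mkp'.
  + by move=> x; exact: mulr_ge0.
  + by move=> x; exact: mulr_ge0.
Qed.

Lemma L1_dist_mixturel_le k k' p :
  subkernel k -> subkernel k' -> subdensity mu p ->
  (L1_dist nu (mixture k p) (mixture k' p) <=
   \int[mu]_x ((p x)%:E * L1_dist nu (k x) (k' x)))%E.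
Proof.
move=> kk kk' pd; have [mp p0 _] := pd.
apply: le_trans (L1_dist_mixture_le kk kk' pd pd) _.
rewrite -(integral_mixture (k := fun x y => `|k x y - k' x y|))//; last first.
  by apply: jointly_measurable_dist; [exact: kk.1|exact: kk'.1].
under eq_integral => y _ do under eq_integral => x _ do
  rewrite -mulrBl normrM (ger0_norm (p0 x)).
exact: lexx.
Qed.

Lemma L1_dist_mixturer_le k p p' : subkernel k -> subdensity mu p ->
  subdensity mu p' ->
  (L1_dist nu (mixture k p) (mixture k p') <= L1_dist mu p p')%E.
Proof.
move=> kk pd pd'; apply: le_trans (L1_dist_mixture_le kk kk pd pd') _.
have [mk kd] := kk; have [mp _ _] := pd; have [mp' _ _] := pd'.
have k0 x y : 0 <= k x y by have [] := kd x.
under eq_integral => y _ do under eq_integral => x _ do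
  rewrite -mulrBr normrM (ger0_norm (k0 x y)).
by apply: integral_mixture_le (measurable_dist mp mp') _.
Qed.

Lemma measurable_L1_dist_rows k k' :
  jointly_measurable k -> jointly_measurable k' ->
  measurable_fun setT (fun x => L1_dist nu (k x) (k' x)).
Proof.
move=> mk mk'; apply: measurable_integral_joint.
exact: jointly_measurable_dist.
Qed.

End mixture_theory.

Lemma subkernel_mixture d1 d2 d3 (X : measurableType d1) (Y : measurableType d2)
    (Z : measurableType d3) (R : realType)
    (mu : {sigma_finite_measure set Y -> \bar R})
    (nu : {sigma_finite_measure set Z -> \bar R})
    (k : X -> Y -> Z -> R) (q : X -> Y -> R) :
  subkernel nu (fun z : X * Y => k z.1 z.2) -> subkernel mu q ->
  subkernel nu (fun x => mixture mu (k x) (q x)).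
Proof.
move=> [mk kd] [mq qd]; split; last first.
  move=> x; apply: subdensity_mixture (qd x).
  split; last by move=> y; exact: (kd (x, y)).
  have mxYZ : measurable_fun setT (fun z : Y * Z => ((x, z.1), z.2)).
    apply: measurable_fun_pair; last exact: measurable_snd.
    by apply: measurable_fun_pair => //; exact: measurable_fst.
  exact: (measurableT_comp mk mxYZ).
apply: (@measurable_Rintegral_joint _ _ _ _ _ mu
  (fun (z : X * Z) y => k z.1 y z.2 * q z.1 y)).
have mX : measurable_fun setT (fun w : (X * Z) * Y => w.1.1).
  exact: (measurableT_comp measurable_fst measurable_fst).
have mZ : measurable_fun setT (fun w : (X * Z) * Y => w.1.2).
  exact: (measurableT_comp measurable_snd measurable_fst).
have mXY := measurable_fun_pair mX (@measurable_snd _ _ (X * Z)%type Y).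
apply: measurable_funM.
- exact: (measurableT_comp mk (measurable_fun_pair mXY mZ)).
- exact: (measurableT_comp mq mXY).
Qed.

Section discounting.
Context {R : realType}.
Variable gamma : R.
Hypothesis gamma01 : 0 <= gamma < 1.

Let gamma_ge0 : 0 <= gamma. Proof. by case/andP: gamma01. Qed.

Let onem_gamma_gt0 : 0 < 1 - gamma.
Proof. by rewrite subr_gt0; case/andP: gamma01. Qed.

Lemma sum_geometric_le (N : nat) :
  \sum_(0 <= t < N) gamma ^+ t <= (1 - gamma)^-1.
Proof.
rewrite big_mkord -[leRHS]mul1r ler_pdivlMr// mulrC -opprB mulNr -subrX1 opprB.
by rewrite lerBlDr lerDl exprn_ge0.
Qed.

Lemma sum_arithmetico_geometricE (N : nat) :
  (\sum_(0 <= t < N) t%:R * gamma ^+ t) * (1 - gamma) ^+ 2 =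
  gamma - gamma ^+ N * (N%:R * (1 - gamma) + gamma).
Proof.
elim: N => [|N IH]; first by rewrite big_nil expr0 mulr0n; ring.
by rewrite big_nat_recr//= mulrDl IH [gamma ^+ N.+1]exprS -natr1; ring.
Qed.

Lemma sum_arithmetico_geometric_le (N : nat) :
  \sum_(0 <= t < N) t%:R * gamma ^+ t <= gamma / (1 - gamma) ^+ 2.
Proof.
rewrite ler_pdivlMr ?exprn_gt0// sum_arithmetico_geometricE lerBlDr lerDl.
by rewrite mulr_ge0 ?exprn_ge0// addr_ge0// mulr_ge0// ltW.
Qed.

Lemma is_cvg_discounted_sum (u : nat -> R) (M : R) : (forall t, `|u t| <= M) ->
  cvgn (fun N => \sum_(0 <= t < N) gamma ^+ t * u t).
Proof.
move=> uM; apply: (@normed_cvg R R^o (fun t => gamma ^+ t * u t)).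
apply: (@series_le_cvg _ _ (geometric M gamma)).
- by move=> t; exact: normr_ge0.
- move=> t; rewrite /geometric mulr_ge0 ?exprn_ge0//.
  exact: le_trans (normr_ge0 _) (uM 0).
- move=> t; rewrite /geometric /= normrM (ger0_norm (exprn_ge0 _ gamma_ge0)).
  by rewrite mulrC ler_wpM2r// exprn_ge0.
- by apply: is_cvg_geometric_series; rewrite ger0_norm//; case/andP: gamma01.
Qed.

Lemma partial_discounted_sum_dist_le (u v : nat -> R) (A B : R) (N : nat) :
  0 <= A -> 0 <= B -> (forall t, `|u t - v t| <= B + t%:R * A) ->
  `|\sum_(0 <= t < N) gamma ^+ t * u t - \sum_(0 <= t < N) gamma ^+ t * v t| <=
  A * (gamma / (1 - gamma) ^+ 2) + B / (1 - gamma).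
Proof.
move=> A0 B0 uv; rewrite -sumrB (le_trans (ler_norm_sum _ _ _))//.
apply: (@le_trans _ _ (A * (\sum_(0 <= t < N) t%:R * gamma ^+ t) +
    B * (\sum_(0 <= t < N) gamma ^+ t))); last first.
  by rewrite lerD// ler_wpM2l ?sum_geometric_le ?sum_arithmetico_geometric_le.
rewrite !mulr_sumr -big_split/=; apply: ler_sum => t _.
rewrite -mulrBr normrM (ger0_norm (exprn_ge0 _ gamma_ge0)).
have -> : A * (t%:R * gamma ^+ t) + B * gamma ^+ t =
  gamma ^+ t * (B + t%:R * A) by ring.
by rewrite ler_wpM2l// exprn_ge0.
Qed.

Lemma discounted_sum_dist_le (T : option nat) (u v : nat -> R) (M A B : R) :
  (forall t, `|u t| <= M) -> (forall t, `|v t| <= M) ->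
  0 <= A -> 0 <= B -> (forall t, `|u t - v t| <= B + t%:R * A) ->
  `|discounted_sum T gamma u - discounted_sum T gamma v| <=
  A * (gamma / (1 - gamma) ^+ 2) + B / (1 - gamma).
Proof.
move=> uM vM A0 B0 uv.
case: T => [T|] /=; first exact: partial_discounted_sum_dist_le.
have cu := is_cvg_discounted_sum uM; have cv := is_cvg_discounted_sum vM.
rewrite -limB// -lim_norm; last exact: is_cvgB.
apply: limr_le; first by apply: is_cvg_norm; exact: is_cvgB.
by apply: nearW => N; exact: partial_discounted_sum_dist_le.
Qed.

End discounting.

Section state_distributions.
Context {R : realType} {d : nat}.
Local Notation S := (d.-tuple R).
Variable mu : {sigma_finite_measure set S -> \bar R}.
Implicit Types (p q : S -> R) (k : S -> S -> R).

Lemma subdensity_state_dist k p t : subkernel mu k -> subdensity mu p ->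
  subdensity mu (state_dist mu p k t).
Proof. by move=> kk pd; elim: t => [//|t IH]; exact: subdensity_mixture. Qed.

Lemma L1_dist_state_dist_le k k' p (c : R) t :
  subkernel mu k -> subkernel mu k' -> subdensity mu p ->
  (forall t, \int[mu]_s ((state_dist mu p k t s)%:E * L1_dist mu (k s) (k' s))
     <= c%:E)%E ->
  (L1_dist mu (state_dist mu p k t) (state_dist mu p k' t) <= (t%:R * c)%:E)%E.
Proof.
move=> kk kk' pd kk'c; elim: t => [|t IH]; first by rewrite L1_distxx mul0r.
have pt := subdensity_state_dist t kk pd.
have qt := subdensity_state_dist t kk' pd.
rewrite -natr1 mulrDl mul1r addrC EFinD.
apply: le_trans (leeD (kk'c t) IH).
apply: le_trans (leeD (L1_dist_mixturel_le kk kk' pt)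
                      (L1_dist_mixturer_le kk' pt qt)).
apply: L1_dist_triangle.
- by have [] := subdensity_mixture kk pt.
- by have [] := subdensity_mixture kk' pt.
- by have [] := subdensity_mixture kk' qt.
Qed.

Lemma L1_dist_TV p q : subdensity mu p -> subdensity mu q ->
  L1_dist mu p q = (2 * TV mu p q)%:E.
Proof.
move=> pd qd; rewrite /TV mulrA divff// mul1r fineK// ge0_fin_numE ?L1_dist_ge0//.
exact: le_lt_trans (L1_dist_subdensity_le2 pd qd) (ltry _).
Qed.

Lemma TV_ge0 p q : 0 <= TV mu p q.
Proof. by rewrite /TV mulr_ge0// Rintegral_ge0. Qed.

Lemma TV_le1 p q : subdensity mu p -> subdensity mu q -> TV mu p q <= 1.
Proof.
move=> pd qd; have := L1_dist_subdensity_le2 pd qd.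
by rewrite L1_dist_TV// lee_fin ger_pMr.
Qed.

Lemma measurable_TV_rows k k' : subkernel mu k -> subkernel mu k' ->
  measurable_fun setT (fun s => TV mu (k s) (k' s)).
Proof.
move=> [mk _] [mk' _]; apply: measurable_funM => //.
by apply: measurableT_comp => //; exact: measurable_L1_dist_rows.
Qed.

Lemma integral_L1_dist_TV k k' p : subkernel mu k -> subkernel mu k' ->
  subdensity mu p ->
  (\int[mu]_s ((p s)%:E * L1_dist mu (k s) (k' s)) =
   (2 * density_mean mu p (fun s => TV mu (k s) (k' s)))%:E)%E.
Proof.
move=> kk kk' pd; have [mp p0 _] := pd.
have mTV := measurable_TV_rows kk kk'.
have TV1 s : `|TV mu (k s) (k' s)| <= 1.
  by rewrite ger0_norm ?TV_ge0// TV_le1//; [exact: kk.2|exact: kk'.2].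
under eq_integral => s _.
  rewrite (L1_dist_TV (kk.2 s) (kk'.2 s)) -EFinM mulrCA; over.
rewrite ge0_integralM_EFin//; first last.
- by move=> s; rewrite mulr_ge0 ?TV_ge0.
- exact: measurable_funM.
have pTV := integrable_density_mean mTV ler01 TV1 pd.
by rewrite EFinM fineK//; exact: integrable_fin_num pTV.
Qed.

End state_distributions.

Section performance.
Context {R : realType} {d : nat}.
Local Notation S := (d.-tuple R).
Variable mu : {sigma_finite_measure set S -> \bar R}.
Implicit Types (p q : S -> R) (pi r : S -> R -> R) (P : S -> R -> S -> R).

Definition mean_reward pi r (s : S) : R :=
  density_mean lebesgue_measure (pi s) (r s).

Definition mean_TV P (p0 : S -> R) pi pi' (t : nat) : R :=
  density_mean mu (state_dist mu p0 (induced_kernel P pi) t)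
    (fun s => TV mu (induced_kernel P pi s) (induced_kernel P pi' s)).

Lemma measurable_mean_reward pi r : subkernel lebesgue_measure pi ->
  jointly_measurable r -> measurable_fun setT (mean_reward pi r).
Proof.
move=> [mpi _] mr.
apply: (@measurable_Rintegral_joint _ _ _ _ _ lebesgue_measure
  (fun s a => pi s a * r s a)).
exact: measurable_funM.
Qed.

Lemma norm_mean_reward_le pi r (M : R) s : subkernel lebesgue_measure pi ->
  jointly_measurable r -> 0 <= M -> (forall s a, `|r s a| <= M) ->
  `|mean_reward pi r s| <= M.
Proof.
move=> [_ pid] mr M0 rM; apply: norm_density_mean_le => //.
exact: jointly_measurable_row.
Qed.

Lemma mean_reward_dist_le pi pi' r (M c : R) s : subkernel lebesgue_measure pi ->
  subkernel lebesgue_measure pi' -> jointly_measurable r ->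
  0 <= M -> (forall s a, `|r s a| <= M) ->
  (L1_dist lebesgue_measure (pi s) (pi' s) <= c%:E)%E ->
  `|mean_reward pi r s - mean_reward pi' r s| <= M * c.
Proof.
move=> [_ pid] [_ pid'] mr M0 rM pic.
apply: density_mean_distl_le pic => //; exact: jointly_measurable_row.
Qed.

Lemma norm_expected_reward_le p pi r (M : R) : subdensity mu p ->
  subkernel lebesgue_measure pi -> jointly_measurable r -> 0 <= M ->
  (forall s a, `|r s a| <= M) -> `|expected_reward mu p pi r| <= M.
Proof.
move=> pd piK mr M0 rM; apply: norm_density_mean_le pd => //.
- exact: measurable_mean_reward.
- by move=> s; exact: norm_mean_reward_le.
Qed.

Lemma subkernel_induced_kernel P pi :
  subkernel mu (fun x : S * R => P x.1 x.2) -> subkernel lebesgue_measure pi ->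
  subkernel mu (induced_kernel P pi).
Proof.
move=> PK piK; exact: (subkernel_mixture (mu := lebesgue_measure) PK piK).
Qed.

Section performance_gap.
Variables (P : S -> R -> S -> R) (p0 : S -> R) (pi pi' r : S -> R -> R).
Variables (M c delta gamma : R).
Hypothesis P_subkernel : subkernel mu (fun x : S * R => P x.1 x.2).
Hypothesis p0_subdensity : subdensity mu p0.
Hypothesis pi_subkernel : subkernel lebesgue_measure pi.
Hypothesis pi'_subkernel : subkernel lebesgue_measure pi'.
Hypotheses (mr : jointly_measurable r) (M0 : 0 <= M).
Hypothesis rM : forall s a, `|r s a| <= M.
Hypothesis c0 : 0 <= c.
Hypothesis mean_reward_gap :
  forall s, `|mean_reward pi r s - mean_reward pi' r s| <= c.

Lemma expected_reward_dist_le p q (e : R) : subdensity mu p -> subdensity mu q ->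
  (L1_dist mu p q <= e%:E)%E ->
  `|expected_reward mu p pi r - expected_reward mu q pi' r| <= c + M * e.
Proof.
move=> pd qd pqe.
have mR := measurable_mean_reward pi_subkernel mr.
have mR' := measurable_mean_reward pi'_subkernel mr.
have RM s := norm_mean_reward_le s pi_subkernel mr M0 rM.
have R'M s := norm_mean_reward_le s pi'_subkernel mr M0 rM.
apply: le_trans (ler_distD (expected_reward mu p pi' r) _ _) _.
apply: lerD; first exact: density_mean_distr_le pd mR mR' M0 c0 RM R'M _.
exact: (density_mean_distl_le mR' M0 R'M pd qd pqe).
Qed.

Hypotheses (gamma01 : 0 <= gamma < 1) (delta0 : 0 <= delta).
Hypothesis mean_TV_le : forall t, mean_TV P p0 pi pi' t <= delta.

Lemma J_dist_le (T : option nat) :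
  `|J mu T gamma p0 P r pi - J mu T gamma p0 P r pi'| <=
  M * (2 * delta) * (gamma / (1 - gamma) ^+ 2) + c / (1 - gamma).
Proof.
have kk := subkernel_induced_kernel P_subkernel pi_subkernel.
have kk' := subkernel_induced_kernel P_subkernel pi'_subkernel.
have pt t := subdensity_state_dist t kk p0_subdensity.
have qt t := subdensity_state_dist t kk' p0_subdensity.
apply: (discounted_sum_dist_le gamma01 _ (M := M)) => //.
- by move=> t; exact: norm_expected_reward_le.
- by move=> t; exact: norm_expected_reward_le.
- by rewrite !mulr_ge0.
- move=> t; rewrite mulrCA; apply: expected_reward_dist_le => //.
  apply: L1_dist_state_dist_le => // t'.
  by rewrite integral_L1_dist_TV// lee_fin ler_pM2l//; exact: mean_TV_le.
Qed.

End performance_gap.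
End performance.

Section restriction.
Context {R : realType}.

Definition supported_in {T : Type} (D : set T) (p : T -> R) :=
  forall x, ~ D x -> p x = 0.

Lemma restrict_in {T : Type} {V : pointedType} (D : set T) (f : T -> V) x :
  D x -> (f \_ D) x = f x.
Proof. by move=> Dx; rewrite /patch mem_set. Qed.

Lemma restrict_out {T : Type} {V : pointedType} (D : set T) (f : T -> V) x :
  ~ D x -> (f \_ D) x = point.
Proof. by move=> Dx; rewrite /patch memNset. Qed.

Context d1 d2 (X : measurableType d1) (Y : measurableType d2).
Variable D : set X.
Hypothesis mD : measurable D.

Lemma measurable_fst_preimage : measurable (@fst X Y @^-1` D).
Proof. by rewrite -[X in measurable X]setTI; exact: measurable_fst. Qed.

Lemma restrict_fst {V : pointedType} (f : X -> Y -> V) :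
  (fun z : X * Y => (f \_ D) z.1 z.2) =
  (fun z => f z.1 z.2) \_ (@fst X Y @^-1` D).
Proof.
apply/funext => z; have [Dz|Dz] := pselect (D z.1); first by rewrite !restrict_in.
by rewrite !restrict_out.
Qed.

Lemma jointly_measurable_restrict (f : X -> Y -> R) :
  jointly_measurable f -> jointly_measurable (f \_ D).
Proof.
move=> mf; rewrite /jointly_measurable restrict_fst.
apply/(measurable_restrictT _ measurable_fst_preimage).
exact: measurable_funTS.
Qed.

Lemma subkernel_restrict (nu : {measure set Y -> \bar R}) (k : X -> Y -> R) :
  jointly_measurable k -> (forall x, D x -> subdensity nu (k x)) ->
  subkernel nu (k \_ D).
Proof.
move=> mk kd; split; first exact: jointly_measurable_restrict.
move=> x; have [Dx|Dx] := pselect (D x).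
- by rewrite restrict_in//; exact: kd.
- by rewrite restrict_out//; exact: subdensity0.
Qed.

Lemma eq_density_mean (mu : {measure set X -> \bar R}) (p u v : X -> R) :
  supported_in D p -> (forall x, D x -> u x = v x) ->
  density_mean mu p u = density_mean mu p v.
Proof.
move=> pD uv; apply: eq_Rintegral => x _.
by have [Dx|Dx] := pselect (D x); [rewrite uv|rewrite pD// !mul0r].
Qed.

Lemma eq_mixture (mu : {measure set X -> \bar R}) (k k' : X -> Y -> R)
    (p : X -> R) :
  supported_in D p -> (forall x, D x -> k x = k' x) ->
  mixture mu k p = mixture mu k' p.
Proof.
move=> pD kk'; apply/funext => y; apply: eq_Rintegral => x _.
by have [Dx|Dx] := pselect (D x); [rewrite kk'|rewrite pD// !mulr0].
Qed.

Lemma supported_in_mixture (mu : {measure set X -> \bar R})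
    (E : set Y) (k : X -> Y -> R) (p : X -> R) :
  supported_in D p -> (forall x, D x -> supported_in E (k x)) ->
  supported_in E (mixture mu k p).
Proof.
move=> pD kE y Ey; apply: Rintegral_eq0 => x.
by have [Dx|Dx] := pselect (D x); [rewrite kE// mul0r|rewrite pD// mulr0].
Qed.

End restriction.

Section invariant_set.
Context {R : realType} {d : nat}.
Local Notation S := (d.-tuple R).
Variable mu : {sigma_finite_measure set S -> \bar R}.
Variables (D : set S) (P : S -> R -> S -> R) (p0 : S -> R).
Hypothesis p0_D : supported_in D p0.
Hypothesis P_D : forall s a, D s -> supported_in D (P s a).
Implicit Types (pi r : S -> R -> R).

Lemma supported_in_induced_kernel pi s : D s ->
  supported_in D (induced_kernel P pi s).
Proof.
by move=> Ds s' Ds'; apply: Rintegral_eq0 => a; rewrite P_D// mul0r.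
Qed.

Lemma supported_in_state_dist pi t :
  supported_in D (state_dist mu p0 (induced_kernel P pi) t).
Proof.
elim: t => [//|t IH]; apply: supported_in_mixture IH _.
exact: supported_in_induced_kernel.
Qed.

Lemma induced_kernel_restrict pi s : D s ->
  induced_kernel (P \_ D) pi s = induced_kernel P pi s.
Proof. by move=> Ds; rewrite /induced_kernel restrict_in. Qed.

Lemma state_dist_restrict pi t :
  state_dist mu p0 (induced_kernel (P \_ D) pi) t =
  state_dist mu p0 (induced_kernel P pi) t.
Proof.
elim: t => [//|t /= ->]; apply: eq_mixture (supported_in_state_dist pi t) _.
exact: induced_kernel_restrict.
Qed.

Lemma mean_TV_restrict pi pi' t :
  mean_TV mu (P \_ D) p0 pi pi' t = mean_TV mu P p0 pi pi' t.
Proof.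
rewrite /mean_TV state_dist_restrict.
apply: eq_density_mean (supported_in_state_dist pi t) _ => s Ds.
by rewrite !induced_kernel_restrict.
Qed.

Lemma J_restrict (T : option nat) (gamma : R) r pi :
  J mu T gamma p0 (P \_ D) (r \_ D) pi = J mu T gamma p0 P r pi.
Proof.
rewrite /J; congr discounted_sum; apply/funext => t; rewrite state_dist_restrict.
apply: eq_density_mean (supported_in_state_dist pi t) _ => s Ds.
by rewrite restrict_in.
Qed.

Lemma J_dist_le_on (T : option nat) r pi pi' (M c delta gamma : R) :
  measurable D -> D !=set0 ->
  jointly_measurable (fun x : S * R => P x.1 x.2) ->
  (forall s a, D s -> subdensity mu (P s a)) -> subdensity mu p0 ->
  subkernel lebesgue_measure pi -> subkernel lebesgue_measure pi' ->
  jointly_measurable r -> (forall s a, D s -> `|r s a| <= M) ->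
  (forall s, D s -> L1_dist lebesgue_measure (pi s) (pi' s) <= c%:E)%E ->
  0 <= gamma < 1 -> 0 <= delta ->
  (forall t, mean_TV mu P p0 pi pi' t <= delta) ->
  `|J mu T gamma p0 P r pi - J mu T gamma p0 P r pi'| <=
  M * (2 * delta) * (gamma / (1 - gamma) ^+ 2) + M * c / (1 - gamma).
Proof.
move=> mD [s0 Ds0] mP Pd p0d piK pi'K mr rM pic gamma01 delta0 TVdelta.
have M0 : 0 <= M by exact: le_trans (normr_ge0 _) (rM s0 0 Ds0).
have c0 : 0 <= c by rewrite -lee_fin (le_trans (L1_dist_ge0 _ _ _) (pic s0 Ds0)).
have mrD := jointly_measurable_restrict mD mr.
have rDM s a : `|(r \_ D) s a| <= M.
  have [Ds|Ds] := pselect (D s); first by rewrite restrict_in// rM.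
  by rewrite restrict_out// normr0.
have PK : subkernel mu (fun x : S * R => (P \_ D) x.1 x.2).
  rewrite restrict_fst; apply: subkernel_restrict => [|//|x Dx]; last exact: Pd.
  exact: measurable_fst_preimage.
have mean_c s :
    `|mean_reward pi (r \_ D) s - mean_reward pi' (r \_ D) s| <= M * c.
  have [Ds|Ds] := pselect (D s).
    exact: mean_reward_dist_le piK pi'K mrD M0 rDM (pic s Ds).
  have r0 q : mean_reward q (r \_ D) s = 0.
    by apply: Rintegral_eq0 => a; rewrite restrict_out// mulr0.
  by rewrite !r0 subrr normr0 mulr_ge0.
have TVD t : mean_TV mu (P \_ D) p0 pi pi' t <= delta.
  by rewrite mean_TV_restrict.
rewrite -(J_restrict T gamma r pi) -(J_restrict T gamma r pi').
exact: (J_dist_le PK p0d piK pi'K mrD M0 rDM (mulr_ge0 M0 c0) mean_c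
  gamma01 delta0 TVD).
Qed.

End invariant_set.

Section pruned_network.
Context {R : realType} {d : nat}.
Local Notation S := (d.-tuple R).

Lemma measurable_cube : measurable (@cube R d).
Proof.
rewrite (_ : cube = \bigcap_(k in [set: 'I_d])
    ((fun s : S => tnth s k) @^-1` `[0, 1]%classic)).
  apply: fin_bigcap_measurable => // k _.
  by rewrite -[X in measurable X]setTI; exact: measurable_tnth.
by apply/seteqP; split=> s cs k; [move=> _|]; have := cs k;
  rewrite /= in_itv/=; exact.
Qed.

Lemma cube_neq0 : @cube R d !=set0.
Proof. by exists (nseq_tuple d 0) => k; rewrite tnth_nseq lexx ler01. Qed.

Lemma subkernel_gauss_policy (m : S -> R) (sig : R) : sig != 0 ->
  measurable_fun setT m -> subkernel lebesgue_measure (gauss_policy m sig).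
Proof.
move=> sig0 mm; split; last by move=> s; exact: subdensity_normal_pdf.
rewrite /jointly_measurable (_ : (fun z => _) = fun z : S * R =>
    normal_peak sig * expR (- (z.2 - m z.1) ^+ 2 / (sig ^+ 2 *+ 2))); last first.
  by apply/funext => z; rewrite /gauss_policy normal_pdfE.
apply: measurable_funM => //; apply: measurableT_comp => //.
apply: measurable_funM => //; apply: measurableT_comp => //.
apply: measurable_funX; apply: measurable_funB; first exact: measurable_snd.
exact: (measurableT_comp mm measurable_fst).
Qed.

Section lipschitz_activation.
Variables (phi : R -> R) (L : R).
Hypothesis phi_lipschitz : forall x y, `|phi x - phi y| <= L * `|x - y|.

Lemma lipschitz_const_ge0 : 0 <= L.
Proof.
have := phi_lipschitz 0 1; rewrite sub0r normrN normr1 mulr1.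
exact: le_trans.
Qed.

Lemma continuous_lipschitz : continuous phi.
Proof.
move=> x; apply/cvgrPdist_le => e e0.
have L1 : 0 < L + 1 by rewrite ltr_wpDl ?lipschitz_const_ge0.
near=> y; rewrite (le_trans (phi_lipschitz x y))//.
have -> : e = (L + 1) * (e / (L + 1)) by rewrite mulrCA divff ?mulr1// gt_eqF.
rewrite ler_pM ?lipschitz_const_ge0 ?lerDl//.
by near: y; apply: cvgr_dist_le; [exact: cvg_id|rewrite divr_gt0].
Unshelve. all: by end_near.
Qed.

Variables (H : nat) (W1 : 'I_H -> 'I_d -> R) (b1 W2 : 'I_H -> R) (b2 : R).

Lemma measurable_net : measurable_fun setT (net phi W1 b1 W2 b2).
Proof.
apply: measurable_funD => //; apply: measurable_sum => i.
apply: measurable_funM => //; apply: measurableT_comp.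
  exact: continuous_measurable_fun continuous_lipschitz.
apply: measurable_funD => //; apply: measurable_sum => k.
by apply: measurable_funM => //; exact: measurable_tnth.
Qed.

Lemma net_prune_dist_le (j : 'I_d) (s : S) : cube s ->
  `|net phi W1 b1 W2 b2 s - net phi (prune W1 j) b1 W2 b2 s| <=
  L * \sum_(i < H) `|W2 i * W1 i j|.
Proof.
move=> cs; rewrite /net opprD addrACA subrr addr0 -sumrB.
rewrite (le_trans (ler_norm_sum _ _ _))// mulr_sumr; apply: ler_sum => i _.
rewrite -mulrBr !normrM mulrCA ler_wpM2l//.
rewrite (le_trans (phi_lipschitz _ _))// ler_wpM2l ?lipschitz_const_ge0//.
rewrite opprD addrACA subrr addr0 -sumrB (bigD1 j)//= big1 ?addr0.
  rewrite /prune eqxx mul0r subr0 normrM ler_piMr//.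
  by have /andP[s0 s1] := cs j; rewrite ger0_norm.
by move=> k /negbTE kj; rewrite /prune kj subrr.
Qed.

Variable sig : R.
Hypothesis sig_gt0 : 0 < sig.

Lemma subkernel_gauss_policy_net :
  subkernel lebesgue_measure (gauss_policy (net phi W1 b1 W2 b2) sig).
Proof.
by apply: subkernel_gauss_policy; [rewrite gt_eqF|exact: measurable_net].
Qed.

Lemma L1_dist_gauss_policy_prune_le (j : 'I_d) (s : S) : cube s ->
  (L1_dist lebesgue_measure (gauss_policy (net phi W1 b1 W2 b2) sig s)
     (gauss_policy (net phi (prune W1 j) b1 W2 b2) sig s) <=
   ((L * \sum_(i < H) `|W2 i * W1 i j|) / sig)%:E)%E.
Proof.
move=> cs; apply: le_trans (L1_dist_normal_pdf_le _ _ sig_gt0) _.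
by rewrite lee_fin ler_pM2r ?invr_gt0//; exact: net_prune_dist_le.
Qed.

End lipschitz_activation.

End pruned_network.

Lemma ex_sigma_finite_measure d (T : measurableType d) (R : realType)
    (mu : {measure set T -> \bar R}) : sigma_finite setT mu ->
  exists nu : {sigma_finite_measure set T -> \bar R},
    (nu : {measure set T -> \bar R}) = mu.
Proof.
case: mu => m mc; set mu := Measure.Pack mc => mu_sigma_finite.
pose sigma_finite_mu :=
  isSigmaFinite.Build _ _ _ (Measure.sort mu) mu_sigma_finite.
pose sfinite_mu := isSFinite.Build _ _ _ (Measure.sort mu)
  (sfinite_measure_sigma_finite mu_sigma_finite).
by exists (HB.pack_for (SigmaFiniteMeasure.type T R) (Measure.sort mu)
  sigma_finite_mu sfinite_mu).
Qed.

Theorem theorem1 (R : realType) (d : nat)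
  (mu : {measure set (d.-tuple R) -> \bar R})
  (P : d.-tuple R -> R -> d.-tuple R -> R)
  (p0 : d.-tuple R -> R)
  (r : d.-tuple R -> R -> R) (rmin rmax : R)
  (gamma : R) (T : option nat)
  (H : nat) (phi : R -> R) (a b Lphi : R)
  (W1 : 'I_H -> 'I_d -> R) (b1 : 'I_H -> R) (W2 : 'I_H -> R) (b2 : R)
  (j : 'I_d) (sigf delta : R) :
  (* reference measure on the state space (Lebesgue "ds" in the paper) *)
  sigma_finite setT mu ->
  (* transition density P(s' | s, a) on S = [0,1]^d *)
  measurable_fun setT (fun x : (d.-tuple R * R) * d.-tuple R => P x.1.1 x.1.2 x.2) ->
  (forall s a s', cube s -> 0 <= P s a s') ->
  (forall s a s', cube s -> ~ cube s' -> P s a s' = 0) ->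
  (forall s a, cube s -> (\int[mu]_(s' in setT) (P s a s')%:E = 1)%E) ->
  (* initial state density p^0 (common to both processes) *)
  measurable_fun setT p0 ->
  (forall s, 0 <= p0 s) ->
  (forall s, ~ cube s -> p0 s = 0) ->
  (\int[mu]_(s in setT) (p0 s)%:E = 1)%E ->
  (* reward r : S x A -> [rmin, rmax], |r| <= rmax *)
  measurable_fun setT (fun x : d.-tuple R * R => r x.1 x.2) ->
  (forall s a, cube s -> rmin <= r s a <= rmax) ->
  (forall s a, cube s -> `|r s a| <= rmax) ->
  (* discount *)
  0 <= gamma < 1 ->
  (* activation phi : R -> (a,b), L_phi-Lipschitz *)
  (forall x, a < phi x < b) ->
  (forall x y, `|phi x - phi y| <= Lphi * `|x - y|) ->
  0 < sigf ->
  0 <= delta ->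
  (let pi1 := gauss_policy (net phi W1 b1 W2 b2) sigf in
   let pi2 := gauss_policy (net phi (prune W1 j) b1 W2 b2) sigf in
   let k1 := induced_kernel P pi1 in
   let k2 := induced_kernel P pi2 in
   (forall t : nat,
      \int[mu]_(s in setT)
         (state_dist mu p0 k1 t s * TV mu (k1 s) (k2 s)) <= delta) ->
   `|J mu T gamma p0 P r pi1 - J mu T gamma p0 P r pi2|
     <= 2 * rmax * (gamma * delta / (1 - gamma) ^+ 2
                    + (Lphi * \sum_(i < H) `|W2 i * W1 i j|) / (sigf * (1 - gamma)))).
Proof.
move=> /ex_sigma_finite_measure[{}mu <-] mP P_ge0 P_cube P_mass mp0 p0_ge0 p0_cube
  p0_mass mr _ r_le gamma01 _ phi_lip sigf_gt0 delta_ge0 pi1 pi2 k1 k2 TV_le.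
have P_density s x : cube s -> subdensity mu (P s x).
  move=> cs; split; [|by move=> s'; exact: P_ge0|by rewrite P_mass].
  exact: (measurable_fun_pair2 (s, x) mP).
have P_supported s x : cube s -> supported_in cube (P s x).
  by move=> cs s'; exact: P_cube.
have p0_density : subdensity mu p0 by split=> //; rewrite p0_mass.
have pi1_kernel : subkernel lebesgue_measure pi1 :=
  subkernel_gauss_policy_net phi_lip W1 b1 W2 b2 sigf_gt0.
have pi2_kernel : subkernel lebesgue_measure pi2 :=
  subkernel_gauss_policy_net phi_lip (prune W1 j) b1 W2 b2 sigf_gt0.
set B := Lphi * _.
have B_ge0 : 0 <= B by rewrite mulr_ge0 ?(lipschitz_const_ge0 phi_lip)// sumr_ge0.
(* B / sigf itself is a bound, twice as good as needed. *)
have pi_dist s : cube s ->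
    (L1_dist lebesgue_measure (pi1 s) (pi2 s) <= (2 * (B / sigf))%:E)%E.
  move/(L1_dist_gauss_policy_prune_le phi_lip W1 b1 W2 b2 sigf_gt0 j)/le_trans.
  by apply; rewrite lee_fin ler_peMl ?ler1n// divr_ge0// ltW.
have -> : 2 * rmax *
    (gamma * delta / (1 - gamma) ^+ 2 + B / (sigf * (1 - gamma))) =
    rmax * (2 * delta) * (gamma / (1 - gamma) ^+ 2) +
    rmax * (2 * (B / sigf)) / (1 - gamma).
  by field; rewrite subr_eq0 !gt_eqF//; case/andP: gamma01.
exact: (J_dist_le_on p0_cube P_supported T measurable_cube cube_neq0 mP P_density
  p0_density pi1_kernel pi2_kernel mr r_le pi_dist gamma01 delta_ge0 TV_le).
Qed.
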